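(* Let $S=\{z: a<\operatorname{Re} z<b\}$, $-\infty\le a<b\le\infty$, and let $Z$, $W$ be almost periodic divisors in $S$. Assume (a) $|Z|\cap S'=\emptyset$ for some (nonempty, open) vertical substrip $S'\subset S$; (b) for any vertical substrip $S_0$ of finite width with $\overline{S_0}\subset S$, the set $\{z-w:\ z\in |Z|\cap S_0,\ w\in |W|\cap S_0\}$ is discrete. Then $Z$ and $W$ are at most countable sums of periodic divisors with commensurable periods; that is, there are at most countably many periodic divisors $Z_1,Z_2,\dots$ and $W_1,W_2,\dots$ in $S$ with $Z=\sum_k Z_k$, $W=\sum_k W_k$ (pointwise sums of divisors), where all the periods involved are commensurable (their pairwise ratios are rational).
   Context: A (vertical) strip is a set $\{z\in\mathbb{C}: a<\operatorname{Re} z<b\}$ with $-\infty\le a<b\le\infty$; a substrip of $S$ is a strip of this form contained in $S$. A divisor $Z$ in a domain $D$ is a map $Z:D\to\mathbb{N}\cup\{0\}$ whose support $|Z|=\operatorname{supp}Z$ has no limit points in $D$; equivalently, a sequence of points $\{z_j\}\subset D$ without limit points in $D$, where each point may appear finitely many times (its multiplicity $Z(z)$ is the number of appearances). Divisors are added pointwise. A divisor $Z$ is periodic with period $p\ne 0$ if $Z(z+p)=Z(z)$ for all $z$ (with the domain invariant under translation by $p$). A set $E\subset\mathbb{R}$ is relatively dense if there is $L<\infty$ with $E\cap[\alpha,\alpha+L]\ne\emptyset$ for every $\alpha\in\mathbb{R}$. A divisor $Z=\{z_j\}_{j\in\mathbb{N}}$ in a strip $S$ is almost periodic if for every $\varepsilon>0$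 and every substrip $S^0$ with $\overline{S^0}\subset S$, the set $E_{\varepsilon,S^0}$ of all $\tau\in\mathbb{R}$ for which there exists a bijection $\sigma=\sigma_\tau:\mathbb{N}\to\mathbb{N}$ such that for every $j$, ($z_j\in S^0$ or $z_{\sigma(j)}\in S^0$) implies $|z_j+i\tau-z_{\sigma(j)}|<\varepsilon$, is relatively dense. *)

(* Defs.v *)
From Stdlib Require Import Reals ZArith List.
From Coquelicot Require Import Coquelicot.
Open Scope R_scope.

Definition in_strip (a b : Rbar) (z : C) : Prop :=
  Rbar_lt a (Re z) /\ Rbar_lt (Re z) b.

Definition closure_in_strip (a0 b0 a b : Rbar) : Prop :=
  forall z : C, Rbar_le a0 (Re z) -> Rbar_le (Re z) b0 -> in_strip a b z.

(* divisor in the strip S: a multiplicity map C -> nat, zero outside S,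
   whose support has no limit points in S *)
Definition is_divisor (a b : Rbar) (Z : C -> nat) : Prop :=
  (forall w, ~ in_strip a b w -> Z w = 0%nat) /\
  (forall w, in_strip a b w ->
     exists r, 0 < r /\ forall u, Cmod (u - w)%C < r -> Z u <> 0%nat -> u = w).

Definition enumerates (z : nat -> C) (Z : C -> nat) : Prop :=
  forall w, exists l : list nat,
    NoDup l /\ length l = Z w /\ forall j, In j l <-> z j = w.

Definition bijective_nat (s : nat -> nat) : Prop :=
  exists s', (forall j, s' (s j) = j) /\ (forall j, s (s' j) = j).

Definition relatively_dense (E : R -> Prop) : Prop :=
  exists L : R, forall alpha : R, exists tau, E tau /\ alpha <= tau <= alpha + L.

Definition almost_periodic_divisor (a b : Rbar) (Z : C -> nat) : Prop :=
  is_divisor a b Z /\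
  exists z : nat -> C, enumerates z Z /\
  forall eps : R, 0 < eps ->
  forall a0 b0 : Rbar, Rbar_lt a0 b0 -> closure_in_strip a0 b0 a b ->
  relatively_dense (fun tau : R =>
    exists s : nat -> nat, bijective_nat s /\
      forall j, (in_strip a0 b0 (z j) \/ in_strip a0 b0 (z (s j))) ->
        Cmod (z j + Ci * RtoC tau - z (s j))%C < eps).

Definition periodic_divisor (a b : Rbar) (Z : C -> nat) (p : C) : Prop :=
  is_divisor a b Z /\ p <> 0%C /\
  (forall z : C, in_strip a b z <-> in_strip a b (z + p)%C) /\
  (forall z : C, Z (z + p)%C = Z z).

Definition commensurable (p q : C) : Prop :=
  exists m n : Z, n <> 0%Z /\ (RtoC (IZR n) * p = RtoC (IZR m) * q)%C.

Definition is_sum_of (Zs : nat -> C -> nat) (Z : C -> nat) : Prop :=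
  forall w, exists N : nat, (forall k, (N <= k)%nat -> Zs k w = 0%nat) /\
    Z w = fold_right Nat.add 0%nat (map (fun k => Zs k w) (seq 0 N)).

Definition discrete_set (D : C -> Prop) : Prop :=
  forall c : C, exists r, 0 < r /\ forall u, D u -> Cmod (u - c)%C < r -> u = c.

(* Main.v *)
Require Import Defs.
From Stdlib Require Import Reals ZArith List Lra Lia.
From Stdlib Require Import Classical IndefiniteDescription FinFun.
From Coquelicot Require Import Coquelicot.
Open Scope R_scope.

(* Pigeonholing differences of almost periods gives a common almost period [tau]
   of [Z] and [W].  Under the corresponding bijections the differences [z - w]
   of nearby points move by a small amount, and they stay in a discrete set, so
   they do not move at all.  As both divisors are relatively dense, chaining
   nearby points shows that all points of a substrip are translated by the same
   [p], close to [i tau].  If [Re p] were nonzero, iterating the translation would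
   carry a zero of [Z] into the zero-free strip; hence [p] is a vertical period
   of both divisors on the substrip.  Exhausting [S] by substrips splits [Z] and
   [W] into periodic pieces, and all periods are commensurable because they are
   periods of the same discrete set of zeros of [Z] on one vertical line. *)

(** * Coordinate estimates for complex numbers *)

Ltac C_coord := unfold Re, Im; simpl; ring.

Lemma C_ext (z w : C) : Re z = Re w -> Im z = Im w -> z = w.
Proof. destruct z, w; simpl; congruence. Qed.

Lemma im_le_Cmod (z : C) : Rabs (Im z) <= Cmod z.
Proof. eapply Rle_trans; [apply Rmax_r | apply Rmax_Cmod]. Qed.

Lemma Cmod_lt_components (z : C) (e : R) :
  Cmod z < e -> - e < Re z < e /\ - e < Im z < e.
Proof.
  intros H; assert (HR := re_le_Cmod z); assert (HI := im_le_Cmod z).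
  apply Rabs_le_between in HR, HI; lra.
Qed.

Lemma Cmod_le_components (z : C) : Cmod z <= Rabs (Re z) + Rabs (Im z).
Proof.
  replace z with ((Re z, 0) + (0, Im z))%C
    by (apply C_ext; C_coord).
  eapply Rle_trans; [apply Cmod_triangle |]; simpl.
  unfold Cmod; simpl.
  replace (Re z * (Re z * 1) + 0 * (0 * 1)) with (Rsqr (Re z)) by (unfold Rsqr; ring).
  replace (0 * (0 * 1) + Im z * (Im z * 1)) with (Rsqr (Im z)) by (unfold Rsqr; ring).
  rewrite !sqrt_Rsqr_abs, !Rplus_0_r, !Rplus_0_l; lra.
Qed.

(** * Pigeonhole arguments on the real line *)

Lemma nat_pigeonhole (f : nat -> nat) (N : nat) :
  (forall n, (f n < N)%nat) -> exists k l, (k < l)%nat /\ f k = f l.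
Proof.
  intros Hf; apply NNPP; intros Hno.
  assert (Hinj : Injective f).
  { intros k l Hkl; destruct (lt_eq_lt_dec k l) as [[H | H] | H]; auto;
      exfalso; apply Hno; eauto. }
  assert (H := NoDup_incl_length (l := map f (seq 0 (S N))) (l' := seq 0 N)
                 (Injective_map_NoDup Hinj (seq_NoDup _ _))).
  rewrite length_map, !length_seq in H.
  enough (S N <= N)%nat by lia.
  apply H; intros x Hx; apply in_map_iff in Hx as (n & <- & _).
  apply in_seq; specialize (Hf n); lia.
Qed.

(** Cut [[-L, L]] into cells of length [eta]: [up] labels the cell, and infinitely many terms share
    finitely many labels. *)
Lemma bounded_close_pair (x : nat -> R) (L eta : R) :
  0 < eta -> (forall n, Rabs (x n) <= L) ->
  exists k l, (k < l)%nat /\ Rabs (x l - x k) < eta.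
Proof.
  intros Heta HL.
  set (r := fun n => (x n + L) / eta).
  assert (Hr : forall n, 0 <= r n <= 2 * L / eta).
  { intros n; specialize (HL n); apply Rabs_le_between in HL; unfold r, Rdiv.
    assert (0 < / eta) by (apply Rinv_0_lt_compat; lra).
    split; [apply Rmult_le_pos | apply Rmult_le_compat_r]; lra. }
  destruct (nat_pigeonhole (fun n => Z.to_nat (up (r n)))
              (S (Z.to_nat (up (2 * L / eta))))) as (k & l & Hkl & Heq).
  { intros n; specialize (Hr n).
    destruct (archimed (r n)) as [A1 A2], (archimed (2 * L / eta)) as [B1 B2].
    assert (up (r n) < up (2 * L / eta) + 1)%Z
      by (apply lt_IZR; rewrite plus_IZR; lra).
    assert (0 < up (r n))%Z by (apply lt_IZR; lra).
    lia. }
  exists k, l; split; [exact Hkl |].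
  assert (Hk := Hr k); assert (Hl := Hr l).
  destruct (archimed (r k)) as [A1 A2], (archimed (r l)) as [B1 B2].
  (* Positive labels survive [Z.to_nat], so equal naturals mean equal labels. *)
  assert (0 < up (r k))%Z by (apply lt_IZR; lra).
  assert (0 < up (r l))%Z by (apply lt_IZR; lra).
  assert (E : up (r k) = up (r l)) by lia.
  rewrite E in *.
  assert (Hd : Rabs (r l - r k) < 1) by (apply Rabs_def1; lra).
  replace (x l - x k) with ((r l - r k) * eta) by (unfold r; field; lra).
  rewrite Rabs_mult, (Rabs_pos_eq eta) by lra.
  rewrite <- (Rmult_1_l eta) at 2; apply Rmult_lt_compat_r; lra.
Qed.

(** Pick a point of [E] and one of [F] from each of a sequence of windows. Their offsets stay
    bounded, so two windows have nearly equal offsets; subtracting these compares the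
    differences. *)
Lemma common_close_differences (E F : R -> Prop) (eta : R) :
  0 < eta -> relatively_dense E -> relatively_dense F ->
  exists t1 t2 s1 s2, E t1 /\ E t2 /\ F s1 /\ F s2 /\
    1 <= t2 - t1 /\ Rabs ((t2 - t1) - (s2 - s1)) < eta.
Proof.
  intros Heta [LE HE] [LF HF].
  apply functional_choice in HE as [t Ht].
  apply functional_choice in HF as [s Hs].
  (* This spacing leaves a gap of length 1 between the windows for [E], whence [1 <= t2 - t1]. *)
  set (K := LE + 1).
  destruct (bounded_close_pair
              (fun n => t (INR n * K) - s (INR n * K)) (LE + LF) eta Heta)
    as (k & l & Hkl & Hclose).
  { intros n; destruct (Ht (INR n * K)) as [_ A], (Hs (INR n * K)) as [_ B].
    apply Rabs_le; lra. }
  exists (t (INR k * K)), (t (INR l * K)), (s (INR k * K)), (s (INR l * K)).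
  destruct (Ht (INR k * K)) as [? A], (Hs (INR k * K)) as [? B],
    (Ht (INR l * K)) as [? A'], (Hs (INR l * K)) as [? B'].
  repeat split; auto.
  - assert (INR k + 1 <= INR l) by (rewrite <- S_INR; apply le_INR; lia).
    assert ((INR k + 1) * K <= INR l * K)
      by (apply Rmult_le_compat_r; unfold K; lra).
    unfold K in *; lra.
  - match goal with |- Rabs ?u < _ =>
      match type of Hclose with Rabs ?v < _ => replace u with v by ring end end.
    exact Hclose.
Qed.

(** * Almost periods and their differences *)

Definition almost_period (z : nat -> C) (A B eps tau : R) : Prop :=
  exists s : nat -> nat, bijective_nat s /\
    forall j, A < Re (z j) < B \/ A < Re (z (s j)) < B ->
      Cmod (z j + Ci * RtoC tau - z (s j))%C < eps.

Lemma Re_add_vertical (z : C) (t : R) : Re (z + Ci * RtoC t)%C = Re z.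
Proof. C_coord. Qed.

Lemma Im_add_vertical (z : C) (t : R) : Im (z + Ci * RtoC t)%C = Im z + t.
Proof. C_coord. Qed.

Lemma shift_close_components (z w : C) (t e : R) :
  Cmod (z + Ci * RtoC t - w)%C < e ->
  Rabs (Re w - Re z) < e /\ Rabs (Im w - (Im z + t)) < e.
Proof.
  intros H; apply Cmod_lt_components in H; unfold Re, Im in *; simpl in H.
  split; apply Rabs_def1; lra.
Qed.

(** Go back by [t1] along the inverse of one matching, then forward by [t2] along the other. The
    errors add up, and the strip shrinks by [e] because the intermediate point may leave it by that
    much. *)
Lemma almost_period_diff (z : nat -> C) (A B A' B' e t1 t2 : R) :
  A + e <= A' -> B' <= B - e -> 0 < e ->
  almost_period z A B e t1 -> almost_period z A B e t2 ->
  almost_period z A' B' (2 * e) (t2 - t1).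
Proof.
  intros HA HB He (s1 & (s1' & I1 & J1) & H1) (s2 & (s2' & I2 & J2) & H2).
  exists (fun j => s2 (s1' j)); split.
  - exists (fun j => s1 (s2' j)); split; intros j.
    + rewrite I2, J1; reflexivity.
    + rewrite I1, J2; reflexivity.
  - intros j Hj.
    assert (K : Cmod (z (s1' j) + Ci * RtoC t1 - z j)%C < e /\
                Cmod (z (s1' j) + Ci * RtoC t2 - z (s2 (s1' j)))%C < e).
    (* Whichever end point lies in the narrow strip forces the intermediate point into the wide one,
       which activates the other estimate. *)
    { specialize (H1 (s1' j)); specialize (H2 (s1' j)); rewrite J1 in H1.
      destruct Hj as [Hj | Hj].
      - assert (K := H1 ltac:(right; lra)); split; [exact K |].
        apply shift_close_components in K as [K _]; apply Rabs_def2 in K.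
        apply H2; left; lra.
      - assert (K := H2 ltac:(right; lra)); split; [| exact K].
        apply shift_close_components in K as [K _]; apply Rabs_def2 in K.
        apply H1; left; lra. }
    destruct K as [K1 K2].
    replace (z j + Ci * RtoC (t2 - t1) - z (s2 (s1' j)))%C with
      ((z (s1' j) + Ci * RtoC t2 - z (s2 (s1' j)))
       + - (z (s1' j) + Ci * RtoC t1 - z j))%C
      by (rewrite RtoC_minus; ring).
    eapply Rle_lt_trans; [apply Cmod_triangle |]; rewrite Cmod_opp; lra.
Qed.

Lemma almost_period_perturb (z : nat -> C) (A B e t t' eta : R) :
  Rabs (t' - t) <= eta ->
  almost_period z A B e t -> almost_period z A B (e + eta) t'.
Proof.
  intros Ht (s & Hs & H); exists s; split; [exact Hs |].
  intros j Hj; specialize (H j Hj).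
  replace (z j + Ci * RtoC t' - z (s j))%C with
    ((z j + Ci * RtoC t - z (s j)) + Ci * RtoC (t' - t))%C
    by (rewrite RtoC_minus; ring).
  eapply Rle_lt_trans; [apply Cmod_triangle |].
  assert (Cmod (Ci * RtoC (t' - t))%C <= eta); [| lra].
  eapply Rle_trans; [apply Cmod_le_components |]; simpl.
  replace (0 * (t' - t) - 1 * 0) with 0 by ring.
  replace (0 * 0 + 1 * (t' - t)) with (t' - t) by ring.
  rewrite Rabs_R0; lra.
Qed.

(** Of the tolerance, [2 * (e / 3)] pays for taking differences and [e / 3] for using the difference
    found for [z] in place of that for [w]. *)
Lemma common_almost_period (z w : nat -> C) (A B A' B' e : R) :
  0 < e -> A + e <= A' -> B' <= B - e ->
  (forall d, 0 < d -> relatively_dense (almost_period z A B d)) ->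
  (forall d, 0 < d -> relatively_dense (almost_period w A B d)) ->
  exists tau, 1 <= tau /\ almost_period z A' B' e tau /\ almost_period w A' B' e tau.
Proof.
  intros He HA HB Hz Hw.
  destruct (common_close_differences _ _ (e / 3) ltac:(lra)
              (Hz (e / 3) ltac:(lra)) (Hw (e / 3) ltac:(lra)))
    as (t1 & t2 & s1 & s2 & T1 & T2 & S1 & S2 & Hge & Hcl).
  assert (P1 := almost_period_diff z A B A' B' (e / 3) t1 t2
                  ltac:(lra) ltac:(lra) ltac:(lra) T1 T2).
  assert (P2 := almost_period_diff w A B A' B' (e / 3) s1 s2
                  ltac:(lra) ltac:(lra) ltac:(lra) S1 S2).
  exists (t2 - t1); split; [exact Hge | split].
  - replace e with (2 * (e / 3) + e / 3) by field.
    eapply almost_period_perturb, P1.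
    replace (t2 - t1 - (t2 - t1)) with 0 by ring; rewrite Rabs_R0; lra.
  - replace e with (2 * (e / 3) + e / 3) by field.
    eapply almost_period_perturb, P2; lra.
Qed.

(** * Discrete sets and chaining *)

(** Compactness of a square makes the pointwise isolation radii uniform. *)
Lemma discrete_uniform_separation (D : C -> Prop) (M : R) :
  discrete_set D ->
  exists e, 0 < e /\ forall u v, D u -> D v ->
    Rabs (Re u) <= M -> Rabs (Im u) <= M -> Cmod (u - v)%C < e -> u = v.
Proof.
  intros HD; apply functional_choice in HD as [r Hr].
  (* With a quarter of the radius, two coordinate errors put [u] within half of it from the centre,
     and [v] is then still inside. *)
  assert (Hpos : forall x y, 0 < r (x, y) / 4)
    by (intros x y; destruct (Hr (x, y)); lra).
  destruct (compactness_value_2d (- M) M (- M) M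
              (fun x y => mkposreal _ (Hpos x y))) as [d Hd].
  exists d; split; [apply cond_pos |].
  intros u v Du Dv Hre Him Huv.
  apply Rabs_le_between in Hre, Him.
  specialize (Hd _ _ Hre Him); apply NNPP in Hd as (x & y & _ & _ & Hx & Hy & Hxy).
  simpl in Hx, Hy, Hxy.
  destruct (Hr (x, y)) as [Hr0 Hrxy].
  assert (Hu : Cmod (u - (x, y))%C < r (x, y) / 2).
  { eapply Rle_lt_trans; [apply Cmod_le_components |].
    replace (Re (u - (x, y))%C) with (Re u - x) by C_coord.
    replace (Im (u - (x, y))%C) with (Im u - y) by C_coord.
    lra. }
  rewrite (Hrxy u Du), (Hrxy v Dv); [reflexivity | | lra].
  replace (v - (x, y))%C with ((u - (x, y)) + - (u - v))%C by ring.
  eapply Rle_lt_trans; [apply Cmod_triangle |]; rewrite Cmod_opp; lra.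
Qed.

(** Values are compared only across the two families. Nearby members of one family are linked
    through a member of the other, distant ones through a chain of such links. *)
Lemma bipartite_chain_constant {T : Type} (y y' : nat -> R) (P P' : nat -> Prop)
    (d d' : nat -> T) (L : R) :
  0 < L ->
  (forall x, exists j, P j /\ x <= y j <= x + L) ->
  (forall x, exists k, P' k /\ x <= y' k <= x + L) ->
  (forall j k, P j -> P' k -> Rabs (y j - y' k) <= 2 * L -> d j = d' k) ->
  exists c, (forall j, P j -> d j = c) /\ (forall k, P' k -> d' k = c).
Proof.
  intros HL Hy Hy' Hd.
  assert (Hbase : forall j i, P j -> P i -> y j <= y i <= y j + 2 * L -> d j = d i).
  { intros j i Pj Pi Hji; destruct (Hy' (y j)) as (k & Pk & Hk).
    transitivity (d' k); [| symmetry]; apply Hd; auto; apply Rabs_le; lra. }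
  assert (Hup : forall n j i, P j -> P i ->
            y j <= y i <= y j + INR n * L -> d j = d i).
  { induction n as [| n IH]; intros j i Pj Pi Hji.
    - apply Hbase; auto; simpl in Hji; lra.
    - rewrite S_INR in Hji.
      destruct (Rle_dec (y i) (y j + 2 * L)) as [Hle | Hgt]; [apply Hbase; auto; lra |].
      (* The height of [m] is between [L] and [2 * L] below that of [i]: low enough for the
         induction hypothesis, near enough for [Hbase]. *)
      destruct (Hy (y i - 2 * L)) as (m & Pm & Hm).
      transitivity (d m); [apply IH | apply Hbase]; auto; lra. }
  assert (Hall : forall j i, P j -> P i -> y j <= y i -> d j = d i).
  { intros j i Pj Pi Hji.
    destruct (INR_unbounded ((y i - y j) / L)) as [n Hn].
    apply (Hup n); auto; split; [lra |].
    apply Rmult_lt_compat_r with (r := L) in Hn; [| lra].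
    replace ((y i - y j) / L * L) with (y i - y j) in Hn by (field; lra); lra. }
  destruct (Hy 0) as (o & Po & _).
  assert (Hc : forall j, P j -> d j = d o).
  { intros j Pj; destruct (Rle_dec (y j) (y o)); [| symmetry]; apply Hall; auto; lra. }
  exists (d o); split; [exact Hc |].
  intros k Pk; destruct (Hy (y' k)) as (j & Pj & Hj).
  rewrite <- (Hc j Pj); symmetry; apply Hd; auto; apply Rabs_le; lra.
Qed.

(** * Divisors given by enumerations *)

Lemma enumerates_nonzero (z : nat -> C) (Z : C -> nat) (w : C) :
  enumerates z Z -> Z w <> 0%nat <-> exists j, z j = w.
Proof.
  intros HE; destruct (HE w) as (l & _ & Hlen & Hl).
  rewrite <- Hlen; split.
  - destruct l as [| j l]; [simpl; lia |].
    intros _; exists j; apply Hl; left; reflexivity.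
  - intros [j Hj]; apply Hl in Hj; destruct l; simpl in *; [tauto | lia].
Qed.

(** The bijection matches the indices over [u] with those over [v], so multiplicities are carried
    over, not just supports. *)
Lemma enumerates_translate (z : nat -> C) (Z : C -> nat) (s : nat -> nat) (u v : C) :
  enumerates z Z -> bijective_nat s ->
  (forall j, z j = u <-> z (s j) = v) -> Z u = Z v.
Proof.
  intros HE (s' & I & J) Huv.
  destruct (HE u) as (l & Nl & <- & Hl), (HE v) as (m & Nm & <- & Hm).
  assert (Hs : Injective s) by (intros i j Hij; rewrite <- (I i), Hij; apply I).
  apply Nat.le_antisymm.
  - rewrite <- (length_map s l).
    apply NoDup_incl_length; [apply Injective_map_NoDup; auto |].
    intros i Hi; apply in_map_iff in Hi as (j & <- & Hj).
    apply Hm, Huv, Hl, Hj.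
  - rewrite <- (length_map s l).
    apply NoDup_incl_length; [auto |].
    intros i Hi; apply in_map_iff; exists (s' i); split; [apply J |].
    apply Hl, Huv; rewrite J; apply Hm, Hi.
Qed.

(** Almost periods move the single point [z j0] near any prescribed height. Every larger [L'] is
    allowed so that both divisors can share one length. *)
Lemma points_relatively_dense (z : nat -> C) (A B m : R) (j0 : nat) :
  0 < m -> A < Re (z j0) < B ->
  (forall d, 0 < d -> relatively_dense (almost_period z (A - m) (B + m) d)) ->
  exists L, 0 < L /\ forall L', L <= L' -> forall x, exists j,
    A - m < Re (z j) < B + m /\ x <= Im (z j) <= x + L'.
Proof.
  intros Hm Hj0 HAP; destruct (HAP m Hm) as [L HL].
  exists (L + 2 * m); split.
  { destruct (HL 0) as (t & _ & Ht); lra. }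
  (* The extra [m] in the start of the window absorbs the error, so the image cannot drop below
     [x]. *)
  intros L' HL' x; destruct (HL (x + m - Im (z j0))) as (t & (s & _ & Hs) & Ht).
  exists (s j0).
  destruct (shift_close_components _ _ _ _ (Hs j0 ltac:(left; lra))) as [HR HI].
  apply Rabs_def2 in HR, HI; lra.
Qed.

(** * From local translations to vertical ones *)

(* A horizontal step shorter than the zero-free gap cannot jump over it.
   The sign of [c] tells whether the gap is approached from the left or the right. *)
Lemma march_into_gap (Z : C -> nat) (c A s t : R) (d u : C) :
  (forall v, A < c * Re v <= s -> Z v <> 0%nat -> Z (v + d)%C <> 0%nat) ->
  (forall v, s < c * Re v < t -> Z v = 0%nat) ->
  0 < c * Re d -> c * Re d < t - s -> A < c * Re u <= s -> Z u <> 0%nat -> False.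
Proof.
  intros Hstep Hgap Hd0 Hd Hu HZ.
  assert (H : forall n, exists v, Z v <> 0%nat /\ A < c * Re v <= s /\
                c * Re v = c * Re u + INR n * (c * Re d)).
  { induction n as [| n (v & Hv & Hs & He)].
    - exists u; split; [auto | split; [auto | simpl; ring]].
    - exists (v + d)%C.
      assert (HR : c * Re (v + d)%C = c * Re v + c * Re d) by C_coord.
      assert (Hvd := Hstep v Hs Hv).
      split; [exact Hvd | rewrite HR, S_INR; split; [| rewrite He; ring]].
      split; [lra |].
      (* A step that passes [s] would land before [t], inside the gap. *)
      apply Rnot_lt_le; intros Hlt; apply Hvd, Hgap; lra. }
  destruct (INR_unbounded ((s - c * Re u) / (c * Re d))) as [n Hn].
  apply Rmult_lt_compat_r with (r := c * Re d) in Hn; [| lra].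
  unfold Rdiv in Hn; rewrite Rmult_assoc, Rinv_l, Rmult_1_r in Hn by lra.
  destruct (H n) as (v & _ & Hv & He); lra.
Qed.

(** Otherwise whichever of [p] and [- p] points from [u] towards the gap would drive [u] into it. *)
Lemma local_translation_vertical (Z : C -> nat) (A B s t : R) (p u : C) :
  A < s -> t < B -> Rabs (Re p) < t - s ->
  (forall v, s < Re v < t -> Z v = 0%nat) ->
  (forall v, A < Re v < B -> Z (v + p)%C = Z v) ->
  (forall v, A < Re v < B -> Z (v - p)%C = Z v) ->
  A < Re u < B -> Z u <> 0%nat -> Re p = 0.
Proof.
  intros HA HB Hp Hgap Hplus Hminus Hu HZ; apply Rabs_def2 in Hp.
  assert (Hright : forall d, (forall v, A < Re v < B -> Z (v + d)%C = Z v) ->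
            0 < Re d < t - s -> Re u <= s -> False).
  { intros d Hd Hd0 Hus.
    apply (march_into_gap Z 1 A s t d u); auto; try lra.
    - intros v Hv; rewrite Hd; auto; lra.
    - intros v Hv; apply Hgap; lra. }
  assert (Hleft : forall d, (forall v, A < Re v < B -> Z (v + d)%C = Z v) ->
            0 < - Re d < t - s -> t <= Re u -> False).
  { intros d Hd Hd0 Hut.
    apply (march_into_gap Z (- 1) (- B) (- t) (- s) d u); auto; try lra.
    - intros v Hv; rewrite Hd; auto; lra.
    - intros v Hv; apply Hgap; lra. }
  assert (Hout : Re u <= s \/ t <= Re u).
  { destruct (Rle_dec (Re u) s); [auto |]; right.
    apply Rnot_lt_le; intros Hlt; apply HZ, Hgap; lra. }
  assert (HN : Re (- p)%C = - Re p) by reflexivity.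
  destruct (Rtotal_order (Re p) 0) as [Hlt | [Heq | Hgt]]; [| exact Heq |]; exfalso;
    destruct Hout as [Hs | Ht].
  - apply (Hright (- p)%C); auto; rewrite HN; lra.
  - apply (Hleft p); auto; lra.
  - apply (Hright p); auto; lra.
  - apply (Hleft (- p)%C); auto; rewrite HN; lra.
Qed.

(* The differences [z j - w k] move by less than the separation of the
   difference set, hence not at all: all nearby points are translated alike. *)
Lemma common_translation (z w : nat -> C) (D : C -> Prop) (A B m L e tau : R)
    (s r : nat -> nat) :
  0 < m -> e <= m -> 0 < L -> 0 <= B - A ->
  (forall j k, A - m < Re (z j) < B + m -> A - m < Re (w k) < B + m ->
     D (z j - w k)%C) ->
  (forall u v, D u -> D v -> Rabs (Re u) <= B - A + 2 * m + 2 * L ->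
     Rabs (Im u) <= B - A + 2 * m + 2 * L -> Cmod (u - v)%C < 2 * e -> u = v) ->
  (forall x, exists j, A < Re (z j) < B /\ x <= Im (z j) <= x + L) ->
  (forall x, exists k, A < Re (w k) < B /\ x <= Im (w k) <= x + L) ->
  (forall j, A < Re (z j) < B -> Cmod (z j + Ci * RtoC tau - z (s j))%C < e) ->
  (forall k, A < Re (w k) < B -> Cmod (w k + Ci * RtoC tau - w (r k))%C < e) ->
  exists p, (forall j, A < Re (z j) < B -> z (s j) = z j + p)%C /\
            (forall k, A < Re (w k) < B -> w (r k) = w k + p)%C.
Proof.
  intros Hm Hem HL HAB HD Hsep Hz Hw Hs Hr.
  destruct (bipartite_chain_constant (fun j => Im (z j)) (fun k => Im (w k))
    (fun j => A < Re (z j) < B) (fun k => A < Re (w k) < B)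
    (fun j => z (s j) - z j)%C (fun k => w (r k) - w k)%C L HL Hz Hw)
    as (p & Hp & Hq).
  - intros j k Hj Hk HIm.
    assert (Sj := Hs j Hj); assert (Rk := Hr k Hk).
    (* The images stray horizontally by less than [e <= m], so both differences belong to [D]; they
       are less than [2 * e] apart. *)
    assert (E : (z j - w k)%C = (z (s j) - w (r k))%C).
    { destruct (shift_close_components _ _ _ _ Sj) as [Sj1 _].
      destruct (shift_close_components _ _ _ _ Rk) as [Rk1 _].
      apply Rabs_def2 in Sj1, Rk1.
      assert (HRe : Re (z j - w k)%C = Re (z j) - Re (w k)) by C_coord.
      assert (HI : Im (z j - w k)%C = Im (z j) - Im (w k)) by C_coord.
      apply Hsep.
      - apply HD; lra.
      - apply HD; lra.
      - rewrite HRe; apply Rabs_le; lra.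
      - rewrite HI; lra.
      - replace (z j - w k - (z (s j) - w (r k)))%C with
          ((z j + Ci * RtoC tau - z (s j)) + - (w k + Ci * RtoC tau - w (r k)))%C
          by ring.
        eapply Rle_lt_trans; [apply Cmod_triangle |]; rewrite Cmod_opp; lra. }
    replace (z (s j) - z j)%C with (z (s j) - w (r k) - (z j - w k) + (w (r k) - w k))%C
      by ring.
    rewrite E; ring.
  - exists p; split; intros i Hi; [rewrite <- (Hp i Hi) | rewrite <- (Hq i Hi)]; ring.
Qed.

Lemma strip_translation (z : nat -> C) (Z : C -> nat) (A B m e tau : R)
    (s : nat -> nat) (p : C) :
  enumerates z Z -> bijective_nat s -> e <= m -> Rabs (Re p) < m ->
  (forall j, A - 2 * m < Re (z j) < B + 2 * m -> z (s j) = z j + p)%C ->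
  (forall j, A - m < Re (z j) < B + m \/ A - m < Re (z (s j)) < B + m ->
     Cmod (z j + Ci * RtoC tau - z (s j))%C < e) ->
  forall v, A < Re v < B -> Z (v + p)%C = Z v /\ Z (v - p)%C = Z v.
Proof.
  intros HE Hs Hem Hp Hsp Hclose v Hv; apply Rabs_def2 in Hp.
  assert (Hgen : forall x, A - m < Re x < B + m -> A - m < Re (x + p)%C < B + m ->
            Z x = Z (x + p)%C).
  { intros x Hx Hxp; apply (enumerates_translate z Z s); auto.
    intros j; split; intros Hj.
    - rewrite <- Hj; apply Hsp; rewrite Hj; lra.
    (* The preimage is not known to lie near [x]: closeness first places it in the wider strip,
       where the translation by [p] is exact. *)
    - assert (K := Hclose j ltac:(right; rewrite Hj; exact Hxp)).
      apply shift_close_components in K as [K _]; apply Rabs_def2 in K.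
      rewrite Hj in K; rewrite Hsp in Hj by lra.
      replace (z j) with (z j + p - p)%C by ring; rewrite Hj; ring. }
  assert (Re (v + p)%C = Re v + Re p) by C_coord.
  assert (Re (v - p)%C = Re v - Re p) by C_coord.
  assert (Hvp : (v - p + p)%C = v) by ring.
  split.
  - symmetry; apply Hgen; lra.
  - rewrite Hgen; rewrite ?Hvp; auto; lra.
Qed.

(** * Real margins for extended endpoints *)

Lemma Rbar_lt_between (a b : Rbar) :
  Rbar_lt a b -> exists x : R, Rbar_lt a x /\ Rbar_lt x b.
Proof.
  destruct a as [a | |], b as [b | |]; simpl; intros H; try tauto.
  - exists ((a + b) / 2); lra.
  - exists (a + 1); lra.
  - exists (b - 1); lra.
  - exists 0; auto.
Qed.

Lemma Rbar_lt_left_margin (a : Rbar) (A : R) :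
  Rbar_lt a A -> exists m, 0 < m /\ forall m', m' <= m -> Rbar_lt a (A - m').
Proof.
  intros H; destruct (Rbar_lt_between _ _ H) as (x & Hax & HxA); simpl in HxA.
  exists (A - x); split; [lra |].
  intros m' Hm'; apply Rbar_lt_le_trans with (Finite x); simpl; auto; lra.
Qed.

Lemma Rbar_opp_lt_iff (x : R) (b : Rbar) :
  Rbar_lt x b <-> Rbar_lt (Rbar_opp b) (- x).
Proof. destruct b; simpl; split; intros; try tauto; lra. Qed.

Lemma strip_margin (a b : Rbar) (A B : R) :
  Rbar_lt a A -> Rbar_lt B b -> exists m, 0 < m /\ forall u : C,
    A - 3 * m <= Re u <= B + 3 * m -> in_strip a b u.
Proof.
  intros HA HB; apply Rbar_opp_lt_iff in HB.
  destruct (Rbar_lt_left_margin _ _ HA) as (m1 & Hm1 & H1).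
  destruct (Rbar_lt_left_margin _ _ HB) as (m2 & Hm2 & H2).
  exists (Rmin m1 m2 / 3).
  assert (0 < Rmin m1 m2) by (apply Rmin_glb_lt; lra).
  assert (Rmin m1 m2 <= m1) by apply Rmin_l.
  assert (Rmin m1 m2 <= m2) by apply Rmin_r.
  split; [lra |]; intros u Hu; split.
  - replace (Re u) with (A - (A - Re u)) by ring; apply H1; lra.
  - apply Rbar_opp_lt_iff.
    replace (- Re u) with (- B - (Re u - B)) by ring; apply H2; lra.
Qed.

(** * A common vertical period on a substrip *)

Lemma strip_common_period (a b : Rbar) (Z W : C -> nat) (A B s t : R) (z0 w0 : C) :
  almost_periodic_divisor a b Z -> almost_periodic_divisor a b W ->
  (forall a0 b0 : R, a0 < b0 -> closure_in_strip (Finite a0) (Finite b0) a b ->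
     discrete_set (fun d => exists z w,
        in_strip (Finite a0) (Finite b0) z /\ Z z <> 0%nat /\
        in_strip (Finite a0) (Finite b0) w /\ W w <> 0%nat /\ d = (z - w)%C)) ->
  Rbar_lt a A -> Rbar_lt B b -> A < s -> s < t -> t < B ->
  (forall v, s < Re v < t -> Z v = 0%nat) ->
  A < Re z0 < B -> Z z0 <> 0%nat -> A < Re w0 < B -> W w0 <> 0%nat ->
  exists q, 0 < q /\ forall v, A < Re v < B ->
    Z (v + Ci * RtoC q)%C = Z v /\ W (v + Ci * RtoC q)%C = W v.
Proof.
  intros (_ & z & EZ & APZ) (_ & w & EW & APW) HD HA HB HAs Hst HtB Hgap Hz0 Zz0 Hw0 Ww0.
  (* Three collars of width [m]: differences are controlled on the outermost, points are translated
     exactly on the next, and the matching is inverted on the innermost. *)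
  destruct (strip_margin a b A B HA HB) as (m & Hm & Hin).
  assert (Hcl : forall x y, A - 3 * m <= x -> y <= B + 3 * m ->
            closure_in_strip (Finite x) (Finite y) a b).
  { intros x y Hx Hy u Hu1 Hu2; simpl in Hu1, Hu2; apply Hin; lra. }
  assert (Hrel : forall x y, A - 3 * m <= x -> x < y -> y <= B + 3 * m ->
            (forall d, 0 < d -> relatively_dense (almost_period z x y d)) /\
            (forall d, 0 < d -> relatively_dense (almost_period w x y d))).
  (* With real endpoints, [almost_period] is convertible to the condition in
     [almost_periodic_divisor]. *)
  { intros x y Hx Hxy Hy; split; intros d Hd;
      [apply (APZ d Hd (Finite x) (Finite y)) | apply (APW d Hd (Finite x) (Finite y))];
      simpl; auto. }
  destruct (proj1 (enumerates_nonzero z Z z0 EZ) Zz0) as [j0 Hj0].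
  destruct (proj1 (enumerates_nonzero w W w0 EW) Ww0) as [k0 Hk0].
  destruct (Hrel (A - m) (B + m)) as [Rz Rw]; try lra.
  destruct (points_relatively_dense z A B m j0 Hm ltac:(rewrite Hj0; lra) Rz)
    as (Lz & HLz & Dz).
  destruct (points_relatively_dense w A B m k0 Hm ltac:(rewrite Hk0; lra) Rw)
    as (Lw & HLw & Dw).
  set (L := Rmax Lz Lw).
  assert (Lz <= L) by apply Rmax_l; assert (Lw <= L) by apply Rmax_r.
  set (D := fun d => exists x y,
        in_strip (A - 3 * m) (B + 3 * m) x /\ Z x <> 0%nat /\
        in_strip (A - 3 * m) (B + 3 * m) y /\ W y <> 0%nat /\ d = (x - y)%C).
  destruct (discrete_uniform_separation D (B - A + 6 * m + 2 * L)) as (e0 & He0 & Hsep).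
  { apply HD; [lra | apply Hcl; lra]. }
  (* [e <= m] keeps images in the next collar, [2 * e <= e0] freezes the differences,
     [e <= 1 <= tau] makes [Im p] positive, and [e <= t - s] keeps the horizontal step shorter than
     the gap. *)
  assert (He : exists e, 0 < e /\ e <= m /\ 2 * e <= e0 /\ e <= 1 /\ e <= t - s).
  { exists (Rmin (Rmin m (e0 / 2)) (Rmin 1 (t - s))).
    assert (U := Rmin_l (Rmin m (e0 / 2)) (Rmin 1 (t - s))).
    assert (V := Rmin_r (Rmin m (e0 / 2)) (Rmin 1 (t - s))).
    assert (U1 := Rmin_l m (e0 / 2)); assert (U2 := Rmin_r m (e0 / 2)).
    assert (V1 := Rmin_l 1 (t - s)); assert (V2 := Rmin_r 1 (t - s)).
    split; [repeat apply Rmin_glb_lt; lra | lra]. }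
  destruct He as (e & He & Hem & Hee0 & He1 & Hets).
  destruct (Hrel (A - 3 * m) (B + 3 * m)) as [Rz' Rw']; try lra.
  destruct (common_almost_period z w (A - 3 * m) (B + 3 * m) (A - 2 * m) (B + 2 * m) e He)
    as (tau & Htau & (sg & Hsg & Sz) & (rh & Hrh & Sw)); auto; try lra.
  destruct (common_translation z w D (A - 2 * m) (B + 2 * m) m L e tau sg rh)
    as (p & Pz & Pw); auto; try lra.
  { intros j k Hj Hk; exists (z j), (w k).
    repeat split; simpl; try lra;
      [apply (enumerates_nonzero z Z) | apply (enumerates_nonzero w W)]; eauto. }
  { intros u v Du Dv Hu Hv Huv; apply Hsep; auto; lra. }
  { intros x; destruct (Dz L ltac:(lra) x) as (j & Hj & Hx); exists j; split; lra. }
  { intros x; destruct (Dw L ltac:(lra) x) as (k & Hk & Hx); exists k; split; lra. }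
  (* The point [z0] moves exactly by [p] and approximately by [i tau]. *)
  assert (Hp : Rabs (Re p) < e /\ Rabs (Im p - tau) < e).
  { assert (K := Sz j0 ltac:(left; rewrite Hj0; lra)).
    rewrite (Pz j0 ltac:(rewrite Hj0; lra)) in K.
    apply shift_close_components in K.
    replace (Re (z j0 + p)%C - Re (z j0)) with (Re p) in K by C_coord.
    replace (Im (z j0 + p)%C - (Im (z j0) + tau)) with (Im p - tau) in K by C_coord.
    exact K. }
  destruct Hp as [HpR HpI].
  assert (TZ := strip_translation z Z A B m e tau sg p EZ Hsg Hem
                  ltac:(lra) Pz ltac:(intros j Hj; apply Sz; lra)).
  assert (TW := strip_translation w W A B m e tau rh p EW Hrh Hem
                  ltac:(lra) Pw ltac:(intros j Hj; apply Sw; lra)).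
  assert (HR0 : Re p = 0).
  { apply (local_translation_vertical Z A B s t p z0); auto; try lra;
      intros v Hv; apply TZ; auto. }
  apply Rabs_def2 in HpI.
  exists (Im p); split; [lra |]; intros v Hv.
  replace (Ci * RtoC (Im p))%C with p
    by (apply C_ext; [rewrite HR0 |]; C_coord).
  split; [apply TZ | apply TW]; auto.
Qed.

(** * Commensurability of vertical periods *)

Lemma vertical_period_multiple (Z : C -> nat) (x q : R) :
  (forall v, Re v = x -> Z (v + Ci * RtoC q)%C = Z v) ->
  forall (n : BinNums.Z) v, Re v = x -> Z (v + Ci * RtoC (IZR n * q))%C = Z v.
Proof.
  intros H n; pattern n; apply Z.peano_ind; clear n.
  - intros v _; f_equal; apply C_ext; C_coord.
  - intros n IH v Hv; rewrite <- (IH v Hv), <- (H (v + Ci * RtoC (IZR n * q))%C)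
      by (rewrite Re_add_vertical; exact Hv).
    f_equal; rewrite succ_IZR; apply C_ext; C_coord.
  - intros n IH v Hv; rewrite <- (IH v Hv), <- H
      by (rewrite Re_add_vertical; exact Hv).
    f_equal; unfold Z.pred; rewrite plus_IZR; apply C_ext; C_coord.
Qed.

(* Incommensurable periods would accumulate translates of [u] at [u]. *)
Lemma vertical_periods_commensurable (Z : C -> nat) (u : C) (r q1 q2 : R) :
  0 < r -> 0 < q1 -> 0 < q2 -> Z u <> 0%nat ->
  (forall v, Cmod (v - u)%C < r -> Z v <> 0%nat -> v = u) ->
  (forall v, Re v = Re u -> Z (v + Ci * RtoC q1)%C = Z v) ->
  (forall v, Re v = Re u -> Z (v + Ci * RtoC q2)%C = Z v) ->
  commensurable (Ci * RtoC q1)%C (Ci * RtoC q2)%C.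
Proof.
  intros Hr Hq1 Hq2 Hu Hiso P1 P2.
  (* Reduction of the multiples of [q1] modulo [q2], with representatives [x k] in [[- q2, 0)]. *)
  set (f := fun k : nat => up (INR k * q1 / q2)).
  set (x := fun k : nat => INR k * q1 - IZR (f k) * q2).
  destruct (bounded_close_pair x q2 r Hr) as (k & l & Hkl & Hx).
  { intros k; unfold x, f; destruct (archimed (INR k * q1 / q2)) as [A1 A2].
    set (n := IZR (up (INR k * q1 / q2))) in *.
    replace (INR k * q1 - n * q2) with (- ((n - INR k * q1 / q2) * q2))
      by (field; lra).
    rewrite Rabs_Ropp, Rabs_mult, !Rabs_pos_eq by lra.
    rewrite <- (Rmult_1_l q2) at 3; apply Rmult_le_compat_r; lra. }
  assert (Hd : x l - x k = IZR (Z.of_nat l - Z.of_nat k) * q1 + IZR (f k - f l) * q2).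
  { rewrite !minus_IZR, <- !INR_IZR_INZ; unfold x; ring. }
  (* The shift is an integer combination of both periods, so it takes [u] to a point of the support
     closer than the isolation radius. *)
  assert (E : (u + Ci * RtoC (x l - x k))%C = u).
  { apply Hiso.
    - replace (u + Ci * RtoC (x l - x k) - u)%C with (Ci * RtoC (x l - x k))%C by ring.
      eapply Rle_lt_trans; [apply Cmod_le_components |].
      replace (Re (Ci * RtoC (x l - x k))%C) with 0 by C_coord.
      replace (Im (Ci * RtoC (x l - x k))%C) with (x l - x k) by C_coord.
      rewrite Rabs_R0; lra.
    - rewrite Hd, RtoC_plus, Cmult_plus_distr_l, Cplus_assoc.
      rewrite (vertical_period_multiple Z (Re u) q2 P2),
        (vertical_period_multiple Z (Re u) q1 P1);
        rewrite ?Re_add_vertical; auto. }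
  assert (H0 : x l - x k = 0).
  { apply (f_equal Im) in E; rewrite Im_add_vertical in E; lra. }
  exists (f l - f k)%Z, (Z.of_nat l - Z.of_nat k)%Z; split; [lia |].
  rewrite (minus_IZR (f k)) in Hd.
  transitivity (Ci * RtoC (IZR (Z.of_nat l - Z.of_nat k) * q1))%C;
    [rewrite RtoC_mult; ring |].
  replace (IZR (Z.of_nat l - Z.of_nat k) * q1) with (IZR (f l - f k) * q2)
    by (rewrite (minus_IZR (f l)); lra).
  rewrite RtoC_mult; ring.
Qed.

(** * Exhaustion of the strip and splitting into pieces *)

(** The bound holds for all large [n], not just for one, so that a single index can serve both ends
    of the strip. *)
Lemma left_exhaustion (a : Rbar) (A : R) :
  Rbar_lt a A -> exists al : nat -> R,
    (forall n, Rbar_lt a (al n) /\ al n <= A) /\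
    (forall x : R, Rbar_lt a x -> exists N, forall n, (N <= n)%nat -> al n < x).
Proof.
  destruct a as [a | |]; simpl; intros HA; [| tauto |].
  - exists (fun n => a + (A - a) / (INR n + 1)); split.
    + intros n; assert (0 <= INR n) by apply pos_INR.
      assert (0 < (A - a) / (INR n + 1)) by (apply Rdiv_lt_0_compat; lra).
      split; [lra |].
      assert ((A - a) / (INR n + 1) <= A - a); [| lra].
      apply Rmult_le_reg_r with (INR n + 1); [lra |].
      replace ((A - a) / (INR n + 1) * (INR n + 1)) with (A - a) by (field; lra).
      nra.
    + intros x Hx; destruct (INR_unbounded ((A - a) / (x - a))) as [N HN].
      exists N; intros n Hn; apply le_INR in Hn.
      assert (0 <= INR n) by apply pos_INR.
      assert ((A - a) / (INR n + 1) < x - a); [| lra].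
      apply Rmult_lt_reg_r with (INR n + 1); [lra |].
      replace ((A - a) / (INR n + 1) * (INR n + 1)) with (A - a) by (field; lra).
      replace (A - a) with ((A - a) / (x - a) * (x - a)) by (field; lra).
      nra.
  - exists (fun n => A - INR n); split.
    + intros n; assert (0 <= INR n) by apply pos_INR; split; [auto | lra].
    + intros x _; destruct (INR_unbounded (A - x)) as [N HN].
      exists N; intros n Hn; apply le_INR in Hn; lra.
Qed.

(** The right end is a left end after reflection. All substrips contain the fixed one between [A]
    and [B], which will hold the gap and a point of each divisor. *)
Lemma strip_exhaustion (a b : Rbar) (A B : R) :
  Rbar_lt a A -> Rbar_lt B b -> exists al be : nat -> R,
    (forall n, Rbar_lt a (al n) /\ al n <= A /\ B <= be n /\ Rbar_lt (be n) b) /\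
    (forall x : R, Rbar_lt a x /\ Rbar_lt x b -> exists n, al n < x < be n).
Proof.
  intros HA HB; apply Rbar_opp_lt_iff in HB.
  destruct (left_exhaustion _ _ HA) as (al & Hal & Eal).
  destruct (left_exhaustion _ _ HB) as (be & Hbe & Ebe).
  exists al, (fun n => - be n); split.
  - intros n; destruct (Hal n) as [? ?], (Hbe n) as [? ?].
    repeat split; auto; [lra |].
    apply Rbar_opp_lt_iff; rewrite Ropp_involutive; auto.
  - intros x [Hax Hxb]; apply Rbar_opp_lt_iff in Hxb.
    destruct (Eal x Hax) as [N HN], (Ebe (- x) Hxb) as [N' HN'].
    exists (Nat.max N N').
    specialize (HN (Nat.max N N') ltac:(lia)); specialize (HN' (Nat.max N N') ltac:(lia)).
    lra.
Qed.

Lemma sum_single (f : nat -> nat) (n : nat) :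
  (forall k, k <> n -> f k = 0%nat) ->
  fold_right Nat.add 0%nat (map f (seq 0 (S n))) = f n.
Proof.
  intros Hf; rewrite seq_S, map_app, fold_right_app; simpl; rewrite Nat.add_0_r.
  assert (H : forall l, ~ In n l -> fold_right Nat.add (f n) (map f l) = f n).
  { induction l as [| k l IH]; simpl; [auto |].
    intros Hl; rewrite IH, Hf; tauto. }
  apply H; rewrite in_seq; lia.
Qed.

(** Sorting by real part alone assigns each vertical line to exactly one piece, so vertical
    translation preserves the pieces. *)
Definition piece (Z : C -> nat) (idx : R -> nat) (k : nat) (u : C) : nat :=
  if Nat.eq_dec (idx (Re u)) k then Z u else 0%nat.

Lemma piece_sum (Z : C -> nat) (idx : R -> nat) : is_sum_of (piece Z idx) Z.
Proof.
  intros u; exists (S (idx (Re u))); split.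
  - intros k Hk; unfold piece; destruct Nat.eq_dec; [lia | reflexivity].
  - rewrite sum_single; unfold piece.
    + destruct Nat.eq_dec; congruence.
    + intros k Hk; destruct Nat.eq_dec; congruence.
Qed.

Lemma piece_periodic (a b : Rbar) (Z : C -> nat) (idx : R -> nat) (k : nat) (q : R) :
  is_divisor a b Z -> 0 < q ->
  (forall u, in_strip a b u -> idx (Re u) = k -> Z (u + Ci * RtoC q)%C = Z u) ->
  periodic_divisor a b (piece Z idx k) (Ci * RtoC q)%C.
Proof.
  intros [Zout Ziso] Hq HZ; repeat apply conj.
  - intros u Hu; unfold piece; destruct Nat.eq_dec; auto.
  - intros u Hu; destruct (Ziso u Hu) as (r & Hr & H); exists r; split; [exact Hr |].
    intros v Hv; unfold piece; destruct Nat.eq_dec; [auto | tauto].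
  - intros E; apply (f_equal Im) in E.
    replace (Im (Ci * RtoC q)%C) with q in E by C_coord; simpl in E; lra.
  - intros u; unfold in_strip; rewrite Re_add_vertical; tauto.
  - intros u; unfold piece; rewrite Re_add_vertical.
    destruct Nat.eq_dec as [Hk | Hk]; [| reflexivity].
    destruct (classic (in_strip a b u)) as [Hu | Hu]; [auto |].
    rewrite !Zout; auto; unfold in_strip in *; rewrite Re_add_vertical; exact Hu.
Qed.

(** * Assembly of the decomposition *)

(** The enumeration runs over all of [nat], so it has a term [z 0]. *)
Lemma almost_periodic_divisor_point (a b : Rbar) (Z : C -> nat) :
  almost_periodic_divisor a b Z -> exists z0, in_strip a b z0 /\ Z z0 <> 0%nat.
Proof.
  intros ([Zout _] & z & EZ & _); exists (z 0%nat).
  assert (Z (z 0%nat) <> 0%nat) by (apply (enumerates_nonzero z Z); eauto).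
  split; [apply NNPP; intros Hn; auto | auto].
Qed.

Theorem theorem2 (a b : Rbar) (Z W : C -> nat) :
  Rbar_lt a b ->
  almost_periodic_divisor a b Z ->
  almost_periodic_divisor a b W ->
  (exists a' b' : Rbar, Rbar_lt a' b' /\ Rbar_le a a' /\ Rbar_le b' b /\
     forall z, in_strip a' b' z -> Z z = 0%nat) ->
  (forall a0 b0 : R, a0 < b0 -> closure_in_strip (Finite a0) (Finite b0) a b ->
     discrete_set (fun d => exists z w,
        in_strip (Finite a0) (Finite b0) z /\ Z z <> 0%nat /\
        in_strip (Finite a0) (Finite b0) w /\ W w <> 0%nat /\ d = (z - w)%C)) ->
  exists (Zs Ws : nat -> C -> nat) (pZ pW : nat -> C),
    (forall k, periodic_divisor a b (Zs k) (pZ k)) /\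
    (forall k, periodic_divisor a b (Ws k) (pW k)) /\
    is_sum_of Zs Z /\ is_sum_of Ws W /\
    (forall k l, commensurable (pZ k) (pZ l) /\ commensurable (pZ k) (pW l) /\
                 commensurable (pW k) (pZ l) /\ commensurable (pW k) (pW l)).
Proof.
  intros _ APZ APW (a' & b' & Hab' & Haa' & Hbb' & Hgap) HD.
  destruct (almost_periodic_divisor_point _ _ _ APZ) as (z0 & [Hz0a Hz0b] & Zz0).
  destruct (almost_periodic_divisor_point _ _ _ APW) as (w0 & [Hw0a Hw0b] & Ww0).
  (* The zero-free strip may be unbounded; a part of it with real edges [s < t] suffices. *)
  destruct (Rbar_lt_between _ _ Hab') as (s & Has & Hsb).
  destruct (Rbar_lt_between _ _ Hsb) as (t & Hst & Htb); simpl in Hst.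
  assert (Hgap' : forall v, s < Re v < t -> Z v = 0%nat).
  { intros v Hv; apply Hgap; split.
    - apply Rbar_lt_trans with (Finite s); simpl; auto; lra.
    - apply Rbar_lt_trans with (Finite t); simpl; auto; lra. }
  assert (HA : exists A : R, Rbar_lt a A /\ A < s /\ A < Re z0 /\ A < Re w0).
  { destruct (Rbar_lt_between a (Rmin s (Rmin (Re z0) (Re w0)))) as (A & HaA & HA).
    - repeat apply Rmin_case; auto; apply Rbar_le_lt_trans with a'; auto.
    - simpl in HA; exists A; split; [exact HaA |].
      assert (U := Rmin_l s (Rmin (Re z0) (Re w0))).
      assert (V := Rmin_r s (Rmin (Re z0) (Re w0))).
      assert (V1 := Rmin_l (Re z0) (Re w0)); assert (V2 := Rmin_r (Re z0) (Re w0)).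
      lra. }
  assert (HB : exists B : R, Rbar_lt B b /\ t < B /\ Re z0 < B /\ Re w0 < B).
  { destruct (Rbar_lt_between (Rmax t (Rmax (Re z0) (Re w0))) b) as (B & HB & HBb).
    - repeat apply Rmax_case; auto; apply Rbar_lt_le_trans with b'; auto.
    - simpl in HB; exists B; split; [exact HBb |].
      assert (U := Rmax_l t (Rmax (Re z0) (Re w0))).
      assert (V := Rmax_r t (Rmax (Re z0) (Re w0))).
      assert (V1 := Rmax_l (Re z0) (Re w0)); assert (V2 := Rmax_r (Re z0) (Re w0)).
      lra. }
  destruct HA as (A & HaA & HAs & HAz & HAw), HB as (B & HBb & HtB & HzB & HwB).
  destruct (strip_exhaustion a b A B HaA HBb) as (al & be & Hn & Hcover).
  assert (Hper : forall n, exists q, 0 < q /\ forall v, al n < Re v < be n ->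
            Z (v + Ci * RtoC q)%C = Z v /\ W (v + Ci * RtoC q)%C = W v).
  { intros n; destruct (Hn n) as (H1 & H2 & H3 & H4).
    apply (strip_common_period a b Z W (al n) (be n) s t z0 w0); auto; lra. }
  apply functional_choice in Hper as [q Hq].
  assert (Hidx : forall x : R, exists n,
            Rbar_lt a x /\ Rbar_lt x b -> al n < x < be n).
  { intros x; destruct (classic (Rbar_lt a x /\ Rbar_lt x b)) as [Hx | Hx].
    - destruct (Hcover x Hx) as [n H]; exists n; auto.
    (* Lines outside the strip get the default index 0; the divisors vanish there. *)
    - exists 0%nat; tauto. }
  apply functional_choice in Hidx as [idx Hidx].
  (* Every substrip contains the line through [z0], so all [q k] are periods of [Z] on that one
     line. *)
  assert (Hcomm : forall k l, commensurable (Ci * RtoC (q k))%C (Ci * RtoC (q l))%C).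
  { intros k l; destruct APZ as [[_ Ziso] _].
    destruct (Ziso z0 (conj Hz0a Hz0b)) as (r & Hr & Hiso).
    apply (vertical_periods_commensurable Z z0 r); auto; try apply Hq.
    - intros v Hv; apply (Hq k); rewrite Hv; specialize (Hn k); lra.
    - intros v Hv; apply (Hq l); rewrite Hv; specialize (Hn l); lra. }
  (* The pieces of [Z] and [W] with the same index share a period, so [Hcomm] covers all four
     comparisons. *)
  exists (piece Z idx), (piece W idx),
    (fun k => Ci * RtoC (q k))%C, (fun k => Ci * RtoC (q k))%C.
  split; [| split; [| split; [apply piece_sum | split; [apply piece_sum | auto]]]];
    intros k; (apply piece_periodic; [first [apply APZ | apply APW] | apply Hq |]);
    intros u Hu Hk; apply (Hq k); rewrite <- Hk; apply Hidx, Hu.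
Qed.
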